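(* The set $\mathcal V$ of all Volterra operators on $S$ is convex and is compact in the weak topology $\tau_w$.
   Context: $S=\{x=(x_n)_{n\in\mathbb N}\in\ell^1 : x_n\ge 0,\ \sum_{n=1}^\infty x_n=1\}$; $\mathrm{Extr}(S)=\{e^{(n)}:n\in\mathbb N\}$, where $e^{(n)}$ has $n$-th coordinate $1$ and all others $0$. A quadratic operator (q.o.) is a map $V:S\to S$, $V(x)=\tilde V(x,x)$, where $(\tilde V(x,y))_k=\sum_{i,j=1}^\infty p_{ij,k}x_iy_j$ for $x,y\in S$, $k\in\mathbb N$, and $(p_{ij,k})_{i,j,k\in\mathbb N}$ satisfies $p_{ij,k}\ge 0$, $p_{ij,k}=p_{ji,k}$, $\sum_{k=1}^\infty p_{ij,k}=1$. The symmetric map $\tilde V$ is uniquely determined by $V$. A q.o. $V$ is a Volterra operator if for all $\varphi,\psi\in\mathrm{Extr}(S)$ one has $\tilde V(\varphi,\psi)\in\{\lambda\varphi+(1-\lambda)\psi:\lambda\in[0,1]\}$. $\mathcal V$ is the set of all Volterra operators; convex combinations of operators are taken pointwise. The weak topology $\tau_w$ on the set of quadratic operators (and the induced one on $\mathcal V$) is the topology defined by the semi-norms $V\mapsto |(\tilde V(\varphi,\psi))_k|$, $\varphi,\psi\in S$, $k\in\mathbb N$; that is, a net $V_\nu$ converges to $V$ iff $(\tilde V_\nu(\varphi,\psi))_k\to(\tilde V(\varphi,\psi))_k$ for all $\varphi,\psi\in S$, $k\in\mathbb N$. *)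

(* Defs.v *)
From HB Require Import structures.
From mathcomp Require Import all_boot all_order all_algebra.
From mathcomp Require Import all_classical all_reals all_analysis.
From mathcomp Require Import ring lra.

Set Implicit Arguments.
Unset Strict Implicit.
Unset Printing Implicit Defensive.

Import Order.TTheory GRing.Theory Num.Theory.
Import numFieldNormedType.Exports.

Local Open Scope classical_set_scope.
Local Open Scope ring_scope.

(* Coordinates are numbered from 0.  Nonnegativity and total mass 1 already
   put a sequence in l^1, so l^1 is not mentioned separately. *)
Definition simplex (R : realType) : set (nat -> R) :=
  [set x | (forall n, 0 <= x n) /\ \esum_(n in [set: nat]) (x n)%:E = 1%E].
Arguments simplex : clear implicits.

Lemma esum_supp (R : realType) (T : choiceType) (s : seq T) (f : T -> R) :
  uniq s -> (forall t, 0 <= f t) -> (forall t, t \notin s -> f t = 0) ->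
  \esum_(t in [set: T]) (f t)%:E = (\sum_(t <- s) f t)%:E.
Proof.
move=> us f0 fs; rewrite (esumID [set` s]); last by move=> t _; rewrite lee_fin.
rewrite !setTI [X in (_ + X)%E]esum1 ?adde0; last first.
  by move=> t /= /negP /fs ->.
rewrite esum_fset; [|exact: finite_seq|by move=> t _; rewrite lee_fin].
by rewrite -fsbig_seq// -sumEFin.
Qed.

Definition basis_vec (R : realType) (n : nat) : nat -> R :=
  fun k => (k == n)%:R.
Arguments basis_vec : clear implicits.

Lemma basis_vec_simplex (R : realType) (n : nat) : simplex R (basis_vec R n).
Proof.
split=> [k|]; first exact: ler0n.
rewrite (@esum_supp _ _ [:: n])// => [|k].
- by rewrite big_seq1 /basis_vec eqxx.
- by rewrite /basis_vec inE => /negPf ->.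
Qed.

Definition vertex (R : realType) (n : nat) : simplex R :=
  SigSub (mem_set (basis_vec_simplex R n)).

Definition extr (R : realType) : set (simplex R) := range (@vertex R).
Arguments extr : clear implicits.

Definition cubic_stochastic (R : realType) (p : nat -> nat -> nat -> R) : Prop :=
  [/\ forall i j k, 0 <= p i j k,
      forall i j k, p i j k = p j i k
    & forall i j, \esum_(k in [set: nat]) (p i j k)%:E = 1%E].

(* For cubic stochastic p and x, y in the simplex all terms are nonnegative
   and the double sum is at most 1, so fine loses nothing. *)
Definition bilin (R : realType) (p : nat -> nat -> nat -> R) (x y : nat -> R) :
    nat -> R :=
  fun k => fine (\esum_(ij in [set: nat * nat])
                   (p ij.1 ij.2 k * x ij.1 * y ij.2)%:E).

Definition represents (R : realType) (p : nat -> nat -> nat -> R)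
    (V : simplex R -> simplex R) : Prop :=
  cubic_stochastic p /\ forall x, val (V x) = bilin p (val x) (val x).

Definition quadratic (R : realType) : set (simplex R -> simplex R) :=
  [set V | exists p, represents p V].
Arguments quadratic : clear implicits.

(* The coefficients are picked by choice; tildeE below shows that the result
   does not depend on the pick. *)
Definition tilde (R : realType) (V : quadratic R) (x y : simplex R) : nat -> R :=
  bilin (projT1 (cid (set_mem (valP V)))) (val x) (val y).

Lemma midpoint_simplex (R : realType) (i j : nat) :
  simplex R (fun k => (basis_vec R i k + basis_vec R j k) / 2).
Proof.
have p0 k : 0 <= (basis_vec R i k + basis_vec R j k) / 2.
  by rewrite divr_ge0 ?addr_ge0 ?ler0n.
split=> //; have [->|ij] := eqVneq i j.
  rewrite (@esum_supp _ _ [:: j])// => [|k|k].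
  - by rewrite big_seq1 /basis_vec eqxx; congr (_%:E); rewrite /=; field.
  - by rewrite divr_ge0 ?addr_ge0 ?ler0n.
  - by rewrite /basis_vec inE => /negPf ->; rewrite addr0 mul0r.
rewrite (@esum_supp _ _ [:: i; j]) => [||k|k].
- rewrite !big_cons big_nil /basis_vec !eqxx (negPf ij) eq_sym (negPf ij).
  by congr (_%:E); rewrite /=; field.
- by rewrite /= inE ij.
- by rewrite divr_ge0 ?addr_ge0 ?ler0n.
- rewrite /basis_vec !inE negb_or => /andP[/negPf -> /negPf ->].
  by rewrite addr0 mul0r.
Qed.

Lemma bilin_supp (R : realType) p (x : nat -> R) s k :
  cubic_stochastic p -> (forall n, 0 <= x n) -> uniq s ->
  (forall n, n \notin s -> x n = 0) ->
  bilin p x x k = \sum_(i <- s) \sum_(j <- s) p i j k * x i * x j.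
Proof.
move=> [p0 _ _] x0 us xs; rewrite /bilin.
rewrite (@esum_supp _ _ [seq (i, j) | i <- s, j <- s]) /=.
- by rewrite big_allpairs.
- by rewrite allpairs_uniq// => -[? ?] [? ?].
- by move=> t; rewrite !mulr_ge0.
- move=> [i j] /=; have [si|/xs ->] := boolP (i \in s); last by rewrite mulr0 mul0r.
  have [sj|/xs ->] := boolP (j \in s); last by rewrite mulr0.
  by rewrite (allpairs_f _ si sj).
Qed.

Lemma represents_inj (R : realType) (V : simplex R -> simplex R) p q :
  represents p V -> represents q V -> p = q.
Proof.
move=> [cp pV] [cq qV].
have E x : simplex R x -> bilin p x x = bilin q x x.
  by move=> Sx; have := pV (SigSub (mem_set Sx)); rewrite qV.
have D i k : p i i k = q i i k.
  have := congr1 (@^~ k) (E _ (basis_vec_simplex R i)).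
  have i0 n : 0 <= basis_vec R i n by exact: ler0n.
  have is0 n : n \notin [:: i] -> basis_vec R i n = 0.
    by rewrite /basis_vec inE => /negPf ->.
  rewrite /= !(bilin_supp (s := [:: i]))// !big_seq1.
  by rewrite /basis_vec eqxx !mulr1.
apply/funext => i; apply/funext => j; apply/funext => k.
have [->|ij] := eqVneq i j; first exact: D.
have := congr1 (@^~ k) (E _ (midpoint_simplex R i j)).
set x := fun n => _.
have x0 n : 0 <= x n by rewrite divr_ge0 ?addr_ge0 ?ler0n.
have xs n : n \notin [:: i; j] -> x n = 0.
  rewrite /x /basis_vec !inE negb_or => /andP[/negPf -> /negPf ->].
  by rewrite addr0 mul0r.
have us : uniq [:: i; j] by rewrite /= inE ij.
rewrite /= !(bilin_supp (s := [:: i; j]))// !big_cons !big_nil.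
have -> : x i = 2^-1 by rewrite /x /basis_vec eqxx (negPf ij) addr0 mul1r.
have -> : x j = 2^-1.
  by rewrite /x /basis_vec eqxx eq_sym (negPf ij) add0r mul1r.
case: cp cq => _ ps _ [_ qs _].
rewrite (ps j i k) (qs j i k) !D; lra.
Qed.

Lemma tildeE (R : realType) (V : quadratic R) p (x y : simplex R) :
  represents p (val V) -> tilde V x y = bilin p (val x) (val y).
Proof.
rewrite /tilde; case: cid => q qV /= pV.
by rewrite (represents_inj pV qV).
Qed.

(* The topology tau_w: the coarsest one making all the maps
   V |-> (tilde V phi psi)_k continuous. *)
Definition weak_qo (R : realType) : Type :=
  initial_topology (fun V : quadratic R =>
    (fun u => tilde V u.1.1 u.1.2 u.2)
      : {ptws simplex R * simplex R * nat -> R}).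

HB.instance Definition _ (R : realType) := Topological.on (weak_qo R).

Lemma cvg_initial (S : choiceType) (T : topologicalType) (f : S -> T)
    (F : set_system S) (s : S) :
  Filter F -> f @ F --> f s -> F --> (s : initial_topology f).
Proof.
move=> FF fF A; rewrite nbhsE => -[B [[C Co <-] Cs]] BA.
by apply: (filterS BA); apply: fF; exact: open_nbhs_nbhs.
Qed.

(* Convergence in tau_w, in terms of filters rather than nets. *)
Lemma cvg_weak_qoP (R : realType) (F : set_system (quadratic R)) :
  Filter F -> forall V : quadratic R,
  F --> (V : weak_qo R) <->
  forall (phi psi : simplex R) (k : nat),
    tilde U phi psi k @[U --> F] --> tilde V phi psi k.
Proof.
move=> FF V; split=> [FV phi psi k|FV].
  pose f (U : quadratic R) : {ptws simplex R * simplex R * nat -> R} :=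
    fun u => tilde U u.1.1 u.1.2 u.2.
  have fF : f @ F --> f V.
    apply: (cvg_trans (cvg_app f FV)).
    exact: (@initial_continuous _ _ f V).
  apply: (cvg_trans (cvg_app (proj (phi, psi, k)) fF)).
  exact: (@proj_continuous _ (fun=> R) (phi, psi, k) (f V)).
apply: cvg_initial; apply/cvg_sup => -[[phi psi] k].
by apply: cvg_initial; exact: FV.
Qed.

Definition volterra (R : realType) : set (quadratic R) :=
  [set V | forall phi psi : simplex R, extr R phi -> extr R psi ->
     exists2 l : R, l \in `[0, 1] &
       tilde V phi psi = l *: val phi + (1 - l) *: val psi].
Arguments volterra : clear implicits.

(* A quadratic operator as a point of the vector space of maps from the
   simplex to real sequences, in which convex combinations are pointwise. *)
Definition map_of (R : realType) (V : quadratic R) : simplex R -> nat -> R :=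
  fun x => val (val V x).

(* Main.v *)
(* A Volterra operator is given by its coefficients p_ij = l e^(i) + (1-l) e^(j)
   with l in [0,1], and it depends affinely on them, whence convexity.  Along an
   ultrafilter the bounded numbers l converge, so the coefficients converge
   pointwise to those of a Volterra operator.  Since
   p_ij,k x_i y_j <= x_i y_j and x_i y_j is summable, dominated convergence
   upgrades this to convergence of all (V~(x, y))_k, i.e. in the weak topology. *)
Require Import Defs.
From HB Require Import structures.
From mathcomp Require Import all_boot all_order all_algebra.
From mathcomp Require Import all_classical all_reals all_analysis.
From mathcomp Require Import ring lra.

Set Implicit Arguments.
Unset Strict Implicit.
Unset Printing Implicit Defensive.

Import Order.TTheory GRing.Theory Num.Theory.
Import numFieldNormedType.Exports.

Local Open Scope classical_set_scope.
Local Open Scope ring_scope.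

(** * Sums over arbitrary index types and limits along filters *)

Lemma esumZl (R : realType) (T : choiceType) (I : set T) (c : R)
    (a : T -> \bar R) : 0 <= c -> (forall t, (0 <= a t)%E) ->
  \esum_(t in I) (c%:E * a t)%E = (c%:E * \esum_(t in I) a t)%E.
Proof.
move=> c0 a0; rewrite /esum -ereal_supZl//; last first.
  by apply/set0P; exists (\sum_(t \in set0) a t)%E; exists set0; first exact: fsets_set0.
congr ereal_sup; rewrite image_comp; apply: eq_imagel => A _ /=.
by rewrite -ge0_mule_fsumr.
Qed.

Lemma exchange_esum (R : realType) (T1 T2 : choiceType)
    (a : T1 -> T2 -> \bar R) : (forall i j, (0 <= a i j)%E) ->
  \esum_(i in [set: T1]) \esum_(j in [set: T2]) a i j =
  \esum_(j in [set: T2]) \esum_(i in [set: T1]) a i j.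
Proof.
move=> a0; rewrite !esum_esum//.
rewrite (@reindex_esum _ _ _ ([set: T2] `*`` (fun=> [set: T1])) _
  (fun z => (z.2, z.1)))//.
split=> [//|[? ?] [? ?] _ _ /= [-> ->]//|[i j] _].
by exists (j, i).
Qed.

(** A Fatou-type bound along a filter. The sum is the supremum of its finite partial sums, so one
    finite partial sum of [d] already exceeds [r]; the same partial sum of [c u] converges to it,
    and each bounds the full sum of [c u] from below. *)
Lemma near_lt_esum (R : realType) (T : choiceType) (I : Type)
    (F : set_system I) (c : I -> T -> R) (d : T -> R) (r : R) : Filter F ->
  (forall t, c u t @[u --> F] --> d t) ->
  (r%:E < \esum_(t in [set: T]) (d t)%:E)%E ->
  \forall u \near F, (r%:E < \esum_(t in [set: T]) (c u t)%:E)%E.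
Proof.
move=> FF cd /ereal_sup_gt[_ [A [finA _] <-]].
rewrite fsumEFin// lte_fin fsbig_finite//= => rA.
have /cvgr_gt/(_ _ rA) : \sum_(t <- finmap.enum_fset (fset_set A)) c u t @[u --> F] -->
    \sum_(t <- finmap.enum_fset (fset_set A)) d t.
  by apply: cvg_big => //; exact: add_continuous.
apply: filterS => u ru; apply/ereal_sup_gtP.
exists (\sum_(t \in A) (c u t)%:E)%E; first by exists A.
by rewrite fsumEFin// lte_fin fsbig_finite.
Qed.

(* The lower semicontinuity above is applied both to [c] and to [w - c], whose
   sums add up to a constant. *)
Lemma esum_dominated_cvg (R : realType) (T : choiceType) (I : Type)
    (F : set_system I) (c : I -> T -> R) (d w : T -> R) : Filter F ->
  (\esum_(t in [set: T]) (w t)%:E < +oo)%E ->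
  (forall u t, 0 <= c u t <= w t) -> (forall t, 0 <= d t <= w t) ->
  (forall t, c u t @[u --> F] --> d t) ->
  fine (\esum_(t in [set: T]) (c u t)%:E) @[u --> F] -->
    fine (\esum_(t in [set: T]) (d t)%:E).
Proof.
move=> FF woo cw dw cd.
have fin (f : T -> R) : (forall t, 0 <= f t <= w t) ->
    \esum_(t in [set: T]) (f t)%:E \is a fin_num.
  move=> fw; rewrite ge0_fin_numE; last first.
    by apply: esum_ge0 => t _; rewrite lee_fin; case/andP: (fw t).
  apply: le_lt_trans woo; apply: le_esum => t _; rewrite lee_fin.
  by case/andP: (fw t).
have compl (f : T -> R) : (forall t, 0 <= f t <= w t) ->
    forall t, 0 <= w t - f t <= w t.
  by move=> fw t; case/andP: (fw t) => f0 fle; rewrite subr_ge0 fle gerBl.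
have split (f : T -> R) : (forall t, 0 <= f t <= w t) ->
    fine (\esum_(t in [set: T]) (w t - f t)%:E) =
    fine (\esum_(t in [set: T]) (w t)%:E)
    - fine (\esum_(t in [set: T]) (f t)%:E).
  move=> fw; apply/eqP; rewrite eq_sym subr_eq -fineD; last 2 first.
  - exact: fin (compl _ fw).
  - exact: fin fw.
  rewrite -esumD.
  - by apply/eqP; congr fine; apply: eq_esum => t _; rewrite -EFinD subrK.
  - by move=> t _; rewrite lee_fin; case/andP: (compl _ fw t).
  - by move=> t _; rewrite lee_fin; case/andP: (fw t).
apply/cvgrPdist_lt => e e0.
have lower : \forall u \near F, fine (\esum_(t in [set: T]) (d t)%:E) - e <
    fine (\esum_(t in [set: T]) (c u t)%:E).
  have := @near_lt_esum R T I F c d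
    (fine (\esum_(t in setT) (d t)%:E) - e) FF cd.
  rewrite -[X in (_ < X)%E -> _]fineK ?fin// lte_fin ltrBlDr ltrDl => /(_ e0).
  by apply: filterS => u; rewrite -[X in (_ < X)%E]fineK ?fin// lte_fin.
have upper : \forall u \near F,
    fine (\esum_(t in [set: T]) (w t - d t)%:E) - e <
    fine (\esum_(t in [set: T]) (w t - c u t)%:E).
  have wcd t : w t - c u t @[u --> F] --> w t - d t.
    by apply: cvgB; [exact: cvg_cst|exact: cd].
  have := @near_lt_esum R T I F (fun u t => w t - c u t) (fun t => w t - d t)
    (fine (\esum_(t in setT) (w t - d t)%:E) - e) FF wcd.
  rewrite -[X in (_ < X)%E -> _]fineK ?(fin _ (compl _ _))//.
  rewrite lte_fin ltrBlDr ltrDl => /(_ e0).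
  apply: filterS => u.
  by rewrite -[X in (_ < X)%E]fineK ?(fin _ (compl _ _))// lte_fin.
(* By [split], the bound on the complementary sums reads: the sum of [c u] is less than the sum of
   [d] plus [e]. *)
move: lower upper; apply: filterS2 => u; rewrite !split// => lo up.
by rewrite distrC ltr_norml; apply/andP; split; lra.
Qed.

Lemma ultra_cvg_compact (I : Type) (T : topologicalType) (F : set_system I)
    (f : I -> T) (K : set T) : UltraFilter F -> compact K ->
  (\forall u \near F, K (f u)) -> exists2 l, K l & f u @[u --> F] --> l.
Proof.
move=> UF /(_ (f @ F)) cK FK.
have [l [Kl clu]] := cK _ FK.
exists l => // A lA.
have [//|FnA] := in_ultra_setVsetC (f @^-1` A) UF.
by have [y []] := clu (~` A) A FnA lA.
Qed.

(** * The simplex and the bilinear map of a cubic stochastic array *)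

Section simplex.
Variable R : realType.
Implicit Types (x y : nat -> R) (p q : nat -> nat -> nat -> R).

Lemma simplex_convex x y (l : R) : l \in `[0, 1] ->
  simplex R x -> simplex R y -> simplex R (l *: x + (1 - l) *: y).
Proof.
rewrite in_itv /= => /andP[l0 l1] [x0 x1] [y0 y1].
have l1' : 0 <= 1 - l by rewrite subr_ge0.
split=> [n|]; first by rewrite addr_ge0// mulr_ge0.
under eq_esum do rewrite EFinD !EFinM.
rewrite esumD//; [|by move=> *; rewrite lee_fin mulr_ge0..].
rewrite !esumZl//; [|by move=> *; rewrite lee_fin..].
by rewrite x1 y1 !mule1 -EFinD addrC subrK.
Qed.

(** The total mass of a product of two probability distributions. The family [x i * y j] is the
    summable majorant in the estimates below. *)
Lemma esum_simplex_prod x y : simplex R x -> simplex R y ->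
  \esum_(ij in [set: nat * nat]) (x ij.1 * y ij.2)%:E = 1%E.
Proof.
move=> [x0 x1] [y0 y1].
have -> : [set: nat * nat] = [set: nat] `*`` (fun=> [set: nat]).
  by apply/seteqP.
rewrite -(esum_esum (a := fun i j => (x i * y j)%:E))//; last first.
  by move=> *; rewrite lee_fin mulr_ge0.
rewrite -x1; apply: eq_esum => i _.
under eq_esum do rewrite EFinM.
by rewrite esumZl// ?y1 ?mule1// => j; rewrite lee_fin.
Qed.

Lemma simplex_le1 x n : simplex R x -> x n <= 1.
Proof.
move=> [x0 x1]; rewrite -lee_fin -x1; apply: esum_ge.
exists [set n]; first by split.
by rewrite fsbig_set1.
Qed.

Lemma cubic_stochastic_simplex p i j : cubic_stochastic p -> simplex R (p i j).
Proof. by case=> p0 _ p1; split. Qed.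

Lemma bilin_bound p x y k i j : cubic_stochastic p ->
  simplex R x -> simplex R y -> 0 <= p i j k * x i * y j <= x i * y j.
Proof.
move=> cp [x0 _] [y0 _].
have [p0 _] := cubic_stochastic_simplex i j cp.
rewrite !mulr_ge0//= -mulrA ler_piMl ?mulr_ge0//.
exact/simplex_le1/cubic_stochastic_simplex.
Qed.

Lemma bilinE p x y k : cubic_stochastic p -> simplex R x -> simplex R y ->
  (bilin p x y k)%:E =
  \esum_(ij in [set: nat * nat]) (p ij.1 ij.2 k * x ij.1 * y ij.2)%:E.
Proof.
move=> cp Sx Sy; rewrite /bilin fineK// ge0_fin_numE; last first.
  apply: esum_ge0 => ij _; rewrite lee_fin.
  by case/andP: (bilin_bound k ij.1 ij.2 cp Sx Sy).
apply: (@le_lt_trans _ _ 1%E); last exact: ltry.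
rewrite -(esum_simplex_prod Sx Sy); apply: le_esum => ij _; rewrite lee_fin.
by case/andP: (bilin_bound k ij.1 ij.2 cp Sx Sy).
Qed.

(** The total mass is found by exchanging sums: for fixed [ij] the sum over [k] of [p i j k] is 1,
    which leaves the mass of the product distribution. *)
Lemma simplex_bilin p x y : cubic_stochastic p ->
  simplex R x -> simplex R y -> simplex R (bilin p x y).
Proof.
move=> cp Sx Sy.
have ge0 k ij : (0 <= (p ij.1 ij.2 k * x ij.1 * y ij.2)%:E)%E.
  by rewrite lee_fin; case/andP: (bilin_bound k ij.1 ij.2 cp Sx Sy).
split=> [k|]; first by rewrite -lee_fin bilinE//; apply: esum_ge0.
under eq_esum do rewrite bilinE//.
rewrite exchange_esum// -(esum_simplex_prod Sx Sy); apply: eq_esum => ij _.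
have [x0 _] := Sx; have [y0 _] := Sy.
have [p0 p1] := cubic_stochastic_simplex ij.1 ij.2 cp.
under eq_esum do rewrite -mulrA mulrC EFinM.
by rewrite esumZl ?p1 ?mule1 ?mulr_ge0// => k; rewrite lee_fin.
Qed.

(** * Quadratic operators and their coefficients *)

Lemma represents_exists p : cubic_stochastic p ->
  exists V : quadratic R, represents p (val V).
Proof.
move=> cp.
pose W (x : simplex R) : simplex R :=
  SigSub (mem_set (simplex_bilin cp (set_mem (valP x)) (set_mem (valP x)))).
have pW : represents p W by split.
have QW : W \in quadratic R by apply/mem_set; exists p.
by exists (SigSub QW).
Qed.

Lemma quadraticP (V : quadratic R) : exists p, represents p (val V).
Proof. exact: set_mem (valP V). Qed.

Lemma bilin_basis_vec p i j : cubic_stochastic p ->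
  bilin p (basis_vec R i) (basis_vec R j) = p i j.
Proof.
move=> [p0 _ _]; apply/funext => k; rewrite /bilin (@esum_supp _ _ [:: (i, j)])//.
- by rewrite big_seq1 /= /basis_vec !eqxx !mulr1.
- by move=> t; rewrite !mulr_ge0// ler0n.
- move=> [i' j']; rewrite inE xpair_eqE negb_and /basis_vec /=.
  by case/orP => /negPf ->; rewrite ?mulr0 ?mul0r.
Qed.

(** This recovers the coefficients from the operator, so that they can be treated as functions of
    it. *)
Lemma tilde_vertex (V : quadratic R) p i j : represents p (val V) ->
  tilde V (vertex R i) (vertex R j) = p i j.
Proof. by move=> pV; rewrite (tildeE _ _ pV) bilin_basis_vec//; case: pV. Qed.

Lemma volterraP (V : quadratic R) p : represents p (val V) ->
  volterra R V <-> forall i j, exists2 l : R, l \in `[0, 1] &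
    p i j = l *: basis_vec R i + (1 - l) *: basis_vec R j.
Proof.
move=> pV; split=> [VV i j|pl _ _ [i _ <-] [j _ <-]].
  rewrite -(tilde_vertex i j pV).
  by have [||l l01 ->] := VV (vertex R i) (vertex R j); [exists i|exists j|exists l].
by rewrite (tilde_vertex i j pV); exact: pl.
Qed.

(** Each [p i j] is a convex combination of two vertices, hence lies in the simplex; together with
    symmetry this makes [p] cubic stochastic. *)
Lemma volterra_exists p : (forall i j k, p i j k = p j i k) ->
  (forall i j, exists2 l : R, l \in `[0, 1] &
    p i j = l *: basis_vec R i + (1 - l) *: basis_vec R j) ->
  exists2 V : quadratic R, volterra R V & represents p (val V).
Proof.
move=> psym pl.
have Sp i j : simplex R (p i j).
  have [l l01 ->] := pl i j.
  by apply: simplex_convex => //; exact: basis_vec_simplex.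
have cp : cubic_stochastic p by split=> // i j => [k|]; case: (Sp i j).
have [V pV] := represents_exists cp.
by exists V => //; apply/(volterraP pV).
Qed.

Lemma bilin_conv p q (t : R) x y : t \in `[0, 1] ->
  cubic_stochastic p -> cubic_stochastic q ->
  cubic_stochastic (t *: p + (1 - t) *: q) ->
  simplex R x -> simplex R y ->
  bilin (t *: p + (1 - t) *: q) x y = t *: bilin p x y + (1 - t) *: bilin q x y.
Proof.
rewrite in_itv /= => /andP[t0 t1] cp cq cr Sx Sy; apply/funext => k.
have t1' : 0 <= 1 - t by rewrite subr_ge0.
have ge0 r : cubic_stochastic r -> forall ij, 0 <= r ij.1 ij.2 k * x ij.1 * y ij.2.
  by move=> cr' ij; case/andP: (bilin_bound k ij.1 ij.2 cr' Sx Sy).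
apply: EFin_inj; rewrite bilinE//.
transitivity (t%:E * (bilin p x y k)%:E + (1 - t)%:E * (bilin q x y k)%:E)%E => //.
rewrite !bilinE// -!esumZl//; [|by move=> ij; rewrite lee_fin ge0..].
rewrite -esumD => [|ij _|ij _].
- apply: eq_esum => ij _; rewrite -!EFinM -EFinD; congr EFin.
  by rewrite /= !mulrA -!mulrDl.
- by rewrite lee_fin mulr_ge0// ge0.
- by rewrite lee_fin mulr_ge0// ge0.
Qed.

(** Values at pairs of vertices are the coefficients; dominated convergence with majorant
    [phi i * psi j] passes from their limits to those of the double sums. *)
Lemma tilde_cvg (F : set_system (quadratic R)) (V : quadratic R) : Filter F ->
  (forall i j k, tilde U (vertex R i) (vertex R j) k @[U --> F] -->
                 tilde V (vertex R i) (vertex R j) k) ->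
  forall phi psi k, tilde U phi psi k @[U --> F] --> tilde V phi psi k.
Proof.
move=> FF FV phi psi k.
pose P (U : quadratic R) i j := tilde U (vertex R i) (vertex R j).
have PE (U : quadratic R) : represents (P U) (val U).
  have [p pU] := quadraticP U.
  suff -> : P U = p by [].
  by apply/funext => i; apply/funext => j; exact: tilde_vertex.
have Sphi := set_mem (valP phi); have Spsi := set_mem (valP psi).
rewrite (tildeE _ _ (PE V)).
under eq_fun do rewrite (tildeE _ _ (PE _)).
apply: (@esum_dominated_cvg _ _ _ _ _ _ (fun ij => val phi ij.1 * val psi ij.2)).
- by rewrite esum_simplex_prod// ltry.
- by move=> U ij; apply: bilin_bound => //; case: (PE U).
- by move=> ij; apply: bilin_bound => //; case: (PE V).
- move=> ij; apply: cvgMl; apply: cvgMl; exact: FV.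
Qed.

(** * Convexity and compactness of the set of Volterra operators *)

Lemma volterra_convex : convex_set (@map_of R @` volterra R).
Proof.
move=> _ _ t /set_mem[V VV <-] /set_mem[W VW <-]; apply/mem_set.
have [p pV] := quadraticP V; have [q qW] := quadraticP W.
have t01 : t%:num \in `[0, 1] by rewrite in_itv /= ge0 le1.
have [cp _] := pV; have [cq _] := qW.
have [||U VU rU] := @volterra_exists (t%:num *: p + (1 - t%:num) *: q).
- move=> i j k; case: cp => _ ps _; case: cq => _ qs _.
  by congr (_ *: _ + _ *: _); [exact: ps|exact: qs].
- move=> i j; have /(_ i j)[l l01 pl] := (volterraP pV).1 VV.
  have /(_ i j)[m m01 qm] := (volterraP qW).1 VW.
  exists (t%:num * l + (1 - t%:num) * m).
    move: l01 m01 t01; rewrite !in_itv /= => /andP[? ?] /andP[? ?] /andP[? ?].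
    by apply/andP; split; nra.
  transitivity (t%:num *: p i j + (1 - t%:num) *: q i j) => //.
  rewrite pl qm; apply/funext => k.
  set ei := basis_vec R i; set ej := basis_vec R j; set s := t%:num.
  rewrite -[LHS]/(s * (l * ei k + (1 - l) * ej k) +
                  (1 - s) * (m * ei k + (1 - m) * ej k)).
  rewrite -[RHS]/((s * l + (1 - s) * m) * ei k +
                  (1 - (s * l + (1 - s) * m)) * ej k).
  ring.
(* The operator with the combined coefficients acts as the pointwise combination, because [bilin] is
   affine in the coefficients. *)
exists U => //; apply/funext => x.
have Sx := set_mem (valP x).
rewrite /map_of; have [cr ->] := rU.
rewrite bilin_conv//; case: pV => _ <-; case: qW => _ <- //.
Qed.

Lemma volterra_compact : @compact (weak_qo R) (volterra R).
Proof.
rewrite compact_ultra => F UF FV.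
pose P (U : quadratic R) i j := tilde U (vertex R i) (vertex R j).
(* The limit weight of [e^(i)] in row [(i, j)] is sought as the limit of the [i]-th coordinate of
   that row, which stays in [[0, 1]] because the row lies in the simplex. *)
have /choice[l Fl] : forall ij : nat * nat, exists l : R, l \in `[0, 1] /\
    P U ij.1 ij.2 ij.1 @[U --> F] --> l.
  move=> ij.
  have [|l l01 Fl] := ultra_cvg_compact UF (@segment_compact R 0 1)
    (f := fun U => P U ij.1 ij.2 ij.1); last by exists l.
  apply: filterE => U; have [p pU] := quadraticP U.
  rewrite /P (tilde_vertex _ _ pU) /= in_itv /=.
  have Sp := cubic_stochastic_simplex ij.1 ij.2 pU.1.
  by rewrite simplex_le1// andbT; case: Sp.
pose p i j : nat -> R :=
  l (i, j) *: basis_vec R i + (1 - l (i, j)) *: basis_vec R j.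
have Fp i j k : P U i j k @[U --> F] --> p i j k.
  (* For a Volterra [U] the whole row is affine in its [i]-th coordinate: for [i != j] that
     coordinate is the weight itself, and for [i = j] every weight gives the same vector.
     Convergence of one coordinate thus gives convergence of all. *)
  have : P U i j i * basis_vec R i k + (1 - P U i j i) * basis_vec R j k
      @[U --> F] --> p i j k.
    have Fij := (Fl (i, j)).2.
    apply: cvgD; apply: cvgMl; first exact: Fij.
    by apply: cvgB; [exact: cvg_cst|exact: Fij].
  apply: cvg_trans; apply: near_eq_cvg; apply: filterS FV => U VU.
  have [||m m01 Pm] := VU (vertex R i) (vertex R j); [by exists i|by exists j|].
  rewrite /P Pm /=.
  rewrite -[RHS]/(m * basis_vec R i k + (1 - m) * basis_vec R j k).
  rewrite -[(m *: _ + _) i]/(m * basis_vec R i i + (1 - m) * basis_vec R j i).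
  rewrite /basis_vec eqxx; have [->|ij] := eqVneq i j; first by ring.
  by rewrite mulr0 addr0 mulr1.
(* Symmetry is not visible in the formula for [p], since the weights for [(i, j)] and [(j, i)] were
   chosen separately; it is inherited from the operators by uniqueness of limits. *)
have psym i j k : p i j k = p j i k.
  apply: (cvg_unique (@Rhausdorff R) (Fp i j k)).
  have -> : (fun U => P U i j k) = (fun U => P U j i k); last exact: Fp.
  apply/funext => U; have [q qU] := quadraticP U.
  by rewrite /P !(tilde_vertex _ _ qU); case: qU => -[_ ->].
have [|V VV pV] := volterra_exists psym.
  by move=> i j; exists (l (i, j)) => //; case: (Fl (i, j)).
exists V; split=> //; apply/cvg_weak_qoP; apply: tilde_cvg => i j k.
by rewrite (tilde_vertex _ _ pV); exact: Fp.
Qed.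

End simplex.

Theorem corollary4p2 (R : realType) :
  convex_set (@map_of R @` volterra R) /\
  @compact (weak_qo R) (volterra R).
Proof. by split; [exact: volterra_convex|exact: volterra_compact]. Qed.
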